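(* Let $G$ be an abelian group with a translation invariant metric $d$ such that $(G,d)$ is separable and complete, let $\Lambda\ne\emptyset$, and let $(A_\lambda)_{\lambda\in\Lambda}$ be generators of Markovian convolution semigroups $(S_\lambda(t))_{t\ge0}$ of linear operators on $\mathrm{BUC}(G)$ such that $D:=\{f\in\bigcap_{\lambda\in\Lambda}D(A_\lambda):\{A_\lambda f:\lambda\in\Lambda\}\text{ is bounded and uniformly equicontinuous}\}$ is dense in $\mathrm{BUC}(G)$. For $t\ge0$ and $f\in\mathrm{BUC}(G)$ let $(\mathcal S(t)f)(x):=\sup_{\pi\in P_t}(J_\pi f)(x)$, $x\in G$, and for $f\in D$ let $\mathcal Af:=\sup_{\lambda\in\Lambda}A_\lambda f\in\mathrm{BUC}(G)$ (pointwise supremum). Then for every $f\in D$, $$\lim_{h\searrow0}\Big\|\frac{\mathcal S(h)f-f}{h}-\mathcal Af\Big\|_\infty=0.$$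
   Context: $\mathrm{BUC}(G)$ is the space of bounded uniformly continuous functions $G\to\mathbb R$, with supremum norm $\|\cdot\|_\infty$. Suprema and monotone limits of functions are pointwise. A convex expectation on $\mathrm{BUC}(G)$ is a map $\mathcal E:\mathrm{BUC}(G)\to\mathbb R$ which is monotone, satisfies $\mathcal E(\alpha)=\alpha$ for constants $\alpha\in\mathbb R$, and is convex. A Markovian convolution semigroup of linear operators on $\mathrm{BUC}(G)$ is a family $(S(t))_{t\ge0}$ of linear maps $\mathrm{BUC}(G)\to\mathrm{BUC}(G)$ such that for each $t$: $f\mapsto(S(t)f)(x)$ is a convex expectation for every $x\in G$, $S(t)f_n\nearrow S(t)f$ for every increasing sequence $(f_n)$ in $\mathrm{BUC}(G)$ converging pointwise to $f\in\mathrm{BUC}(G)$, and $(S(t)f)(x)=(S(t)f_x)(0)$ with $f_x(y):=f(x+y)$; moreover $S(0)f=f$, $S(s+t)=S(s)S(t)$ and $\lim_{t\searrow0}\|S(t)f-f\|_\infty=0$ for all $f\in\mathrm{BUC}(G)$. Its generator is the usual generator of a strongly continuous semigroup. For $f\in\mathrm{BUC}(G)$ and $t\ge0$ let $(J_tf)(x):=\sup_{\lambda\in\Lambda}(S_\lambda(t)f)(x)$, $x\in G$ (again an element of $\mathrm{BUC}(G)$). $P_t$ is the set of finite sets $\pi\subset[0,\infty)$ with $0\in\pi$ and $\max\pi=t$. For $\pi=\{t_0,\dots,t_m\}$ with $0=t_0<t_1<\dots<t_m$ put $J_\pi f:=J_{t_1-t_0}\cdots J_{t_m-t_{m-1}}f$,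 and $J_{\{0\}}f:=f$. *)

(* Defs.v *)
From HB Require Import structures.
From mathcomp Require Import all_boot all_order all_algebra finmap.
From mathcomp Require Import all_classical all_reals all_analysis.

Set Implicit Arguments.
Unset Strict Implicit.
Unset Printing Implicit Defensive.

Import Order.TTheory GRing.Theory Num.Theory.
Import numFieldNormedType.Exports.

Local Open Scope classical_set_scope.
Local Open Scope ring_scope.

(* The metric is an explicit function rather than a [metricType] structure: the
   library's hierarchy admits no join of [metricType] and [zmodType], and its
   normed Z-modules require `|x *+ n| = `|x| *+ n, which a translation
   invariant metric need not satisfy. *)
Section MetricGroups.
Variables (R : realType) (G : zmodType) (d : G -> G -> R).

Record translation_invariant_metric : Prop := TranslationInvariantMetric {
  tim_ge0 : forall x y, 0 <= d x y ;
  tim_eq0 : forall x y, d x y = 0 <-> x = y ;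
  tim_sym : forall x y, d x y = d y x ;
  tim_triangle : forall x y z, d x z <= d x y + d y z ;
  tim_invariant : forall x y z, d (x + z) (y + z) = d x y
}.

Definition metric_separable : Prop :=
  exists2 A : set G, countable A &
    forall x (e : R), 0 < e -> exists2 a, A a & d x a < e.

Definition metric_complete : Prop :=
  forall u : nat -> G,
    (forall e : R, 0 < e -> exists N : nat, forall m n,
      (N <= m)%N -> (N <= n)%N -> d (u m) (u n) < e) ->
    exists x, d (u n) x @[n --> \oo] --> (0 : R).

Definition metric_unif_continuous (f : G -> R) : Prop :=
  forall e : R, 0 < e -> exists2 r : R, 0 < r &
    forall x y, d x y < r -> `|f x - f y| < e.

Definition uniformly_equicontinuous (I : Type) (F : I -> G -> R) : Prop :=
  forall e : R, 0 < e -> exists2 r : R, 0 < r &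
    forall i x y, d x y < r -> `|F i x - F i y| < e.

End MetricGroups.

Section ConvolutionSemigroups.
Variables (R : realType) (G : zmodType) (d : G -> G -> R).
Implicit Types (f g : G -> R) (t : R) (T : (G -> R) -> G -> R)
  (S : R -> (G -> R) -> G -> R).

(* Operators on BUC are total maps on [G -> R]; only their values on BUC are
   constrained or used. *)
Definition BUC : set (G -> R) :=
  [set f | bounded_fun f /\ metric_unif_continuous d f].

(* Extended-real valued, so that an unbounded function has norm +oo. *)
Definition sup_norm f : \bar R := ereal_sup (range (fun x => `|f x|%:E)).

Definition dense_in_BUC (D : set (G -> R)) : Prop :=
  forall f, BUC f -> forall e : R, 0 < e ->
    exists2 g, D g & (sup_norm (f \- g)%R < e%:E)%E.

Definition pointwise_increasing_to (u : nat -> G -> R) f : Prop :=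
  forall x, nondecreasing_seq (fun n => u n x) /\
            u n x @[n --> \oo] --> f x.

Record convex_expectation (E : (G -> R) -> R) : Prop := ConvexExpectation {
  ce_monotone : forall f g, BUC f -> BUC g ->
    (forall x, f x <= g x) -> E f <= E g ;
  ce_cst : forall a : R, E (cst a) = a ;
  ce_convex : forall (a : R) f g, BUC f -> BUC g -> 0 <= a <= 1 ->
    E ((a \*o f) \+ ((1 - a) \*o g)) <= a * E f + (1 - a) * E g
}.

Record markovian_convolution T : Prop := MarkovianConvolution {
  mc_BUC : forall f, BUC f -> BUC (T f) ;
  mc_linear : forall (a : R) f g, BUC f -> BUC g ->
    T ((a \*o f) \+ g) = (a \*o T f) \+ T g ;
  mc_expectation : forall x, convex_expectation (fun f => T f x) ;
  mc_continuous : forall (u : nat -> G -> R) f,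
    (forall n, BUC (u n)) -> BUC f -> pointwise_increasing_to u f ->
    pointwise_increasing_to (fun n => T (u n)) (T f) ;
  mc_translation : forall f x, BUC f -> T f x = T (fun y => f (x + y)) 0
}.

Record markovian_convolution_semigroup S : Prop :=
  MarkovianConvolutionSemigroup {
  mcs_convolution : forall t, 0 <= t -> markovian_convolution (S t) ;
  mcs_0 : forall f, BUC f -> S 0 f = f ;
  mcs_D : forall s t f, 0 <= s -> 0 <= t -> BUC f ->
    S (s + t) f = S s (S t f) ;
  mcs_strong_continuity : forall f, BUC f ->
    sup_norm (S t f \- f) @[t --> 0^'+] --> 0%E
}.

Definition generator_at S f g : Prop :=
  sup_norm (fun x => (S h f x - f x) / h - g x) @[h --> 0^'+] --> 0%E.

(* The operator [A] with domain [dom] is the generator of [S]. *)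
Record is_generator S (dom : set (G -> R)) (A : (G -> R) -> G -> R) : Prop :=
  IsGenerator {
  gen_dom : dom = [set f | BUC f /\ exists2 g, BUC g & generator_at S f g] ;
  gen_op : forall f, dom f -> BUC (A f) /\ generator_at S f (A f)
}.

Section Families.
Variable Lam : Type.
Implicit Types (F : Lam -> G -> R).

Definition uniformly_bounded F : Prop :=
  exists M : R, forall l x, `|F l x| <= M.

Definition common_domain (dom : Lam -> set (G -> R))
    (A : Lam -> (G -> R) -> G -> R) : set (G -> R) :=
  [set f | [/\ forall l, dom l f,
               uniformly_bounded (fun l => A l f) &
               uniformly_equicontinuous d (fun l => A l f)]].

(* The suprema below are real-valued: for [f] in BUC (resp. in the common
   domain) they are taken over nonempty bounded sets as soon as [Lam] is
   nonempty. *)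
Definition sup_generator (A : Lam -> (G -> R) -> G -> R) f : G -> R :=
  fun x => sup (range (fun l => A l f x)).

Definition J (S : Lam -> R -> (G -> R) -> G -> R) t f : G -> R :=
  fun x => sup (range (fun l => S l t f x)).

(* Finite subsets of [0, t] containing both 0 and t. *)
Definition partitions t : set {fset R} :=
  [set pi | [/\ forall s, s \in pi -> 0 <= s, 0 \in pi, t \in pi &
                forall s, s \in pi -> s <= t]].

(* J_seq S [:: t0; ...; tm] f = J S (t1 - t0) (... (J S (tm - t(m-1)) f)). *)
Fixpoint J_seq (S : Lam -> R -> (G -> R) -> G -> R) (s : seq R) f : G -> R :=
  if s is t0 :: s' then
    if s' is t1 :: _ then J S (t1 - t0) (J_seq S s' f) else f
  else f.

Definition J_part (S : Lam -> R -> (G -> R) -> G -> R) (pi : {fset R}) f :=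
  J_seq S (sort <=%R (enum_fset pi)) f.

Definition sup_semigroup (S : Lam -> R -> (G -> R) -> G -> R) t f : G -> R :=
  fun x => sup [set J_part S pi f x | pi in partitions t].

End Families.

End ConvolutionSemigroups.
Arguments partitions {R} t.

(* Main.v *)
(* Testing the semigroups on an element of D close to the function
   y |-> min(1, d(0, y) / r) shows that the S_l(t) move little mass beyond
   distance r as t -> 0, uniformly in l. Hence S_l(s) A_l f -> A_l f and
   S_l(t) f = f + t A_l f + o(t) uniformly in l, and the lower bound follows from
   the partition {0, h}. For the upper bound one replaces sup_l A_l f by a nearby
   psi in D: since J_s psi <= psi + s C, induction along a partition of [0, h]
   gives J_pi f <= f + h (psi + e) + h^2 C, independently of the partition. *)
Require Import Defs.
From HB Require Import structures.
From mathcomp Require Import all_boot all_order all_algebra finmap.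
From mathcomp Require Import all_classical all_reals all_analysis.
From mathcomp Require Import lra.

Set Implicit Arguments.
Unset Strict Implicit.
Unset Printing Implicit Defensive.

Import Order.TTheory GRing.Theory Num.Theory.
Import numFieldNormedType.Exports.

Local Open Scope classical_set_scope.
Local Open Scope ring_scope.

(** * Suprema, sorted lists, convergence in the supremum norm *)

Lemma le_sup_range (R : realType) (I : Type) (F : I -> R) (M : R) (i : I) :
  (forall j, `|F j| <= M) -> F i <= sup (range F).
Proof.
move=> FM; apply: ub_le_sup; last by exists i.
by exists M => _ [j _ <-]; rewrite (le_trans (ler_norm _)).
Qed.

Lemma sup_range_le (R : realType) (I : Type) (F : I -> R) (c : R) :
  [set: I] !=set0 -> (forall i, F i <= c) -> sup (range F) <= c.
Proof.
move=> [i _] Fc; apply: ge_sup; first by exists (F i), i.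
by move=> _ [j _ <-].
Qed.

Lemma path_le_last (R : realDomainType) (a : R) (s : seq R) :
  path <=%R a s -> forall x, x \in a :: s -> x <= last a s.
Proof.
elim: s a => [|b s IHs] a /=; first by move=> _ x; rewrite inE => /eqP->.
move=> /andP[ab pths] x; rewrite inE => /predU1P[->|]; last exact: IHs.
by rewrite (le_trans ab)// IHs ?mem_head.
Qed.

(** Trades convergence of extended-real norms for one radius valid at all points; the bound is
    non-strict because only [<=] passes to a supremum. *)
Lemma cvg_sup_norm0 (R : realType) (G : zmodType) (u : R -> G -> R) :
  sup_norm (u h) @[h --> 0^'+] --> 0%E <->
  forall e, 0 < e ->
    exists2 r, 0 < r & forall h x, 0 < h -> h < r -> `|u h x| <= e.
Proof.
have sup_ge0 h : (0 <= sup_norm (u h))%E.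
  by apply: le_trans (ereal_sup_ubound _); last by exists 0.
split.
- move=> /fine_cvgP[fin_u cvg_u] e e0.
  have /cvgrPdist_lt/(_ e e0) near_e := cvg_u.
  have : \forall h \near 0^'+, forall x, `|u h x| <= e.
    near=> h => x.
    have fh : sup_norm (u h) \is a fin_num by near: h.
    have : `|0 - fine (sup_norm (u h))| < e by near: h.
    rewrite sub0r normrN ger0_norm ?fine_ge0// => /ltW lee.
    rewrite (le_trans _ lee)// -lee_fin fineK//.
    by apply: ereal_sup_ubound; exists x.
  rewrite /at_right /within /= => /nbhs_ballP[r /= r0 rP].
  exists r => // h x h0 hr; apply: rP => //=.
  by rewrite /ball /= sub0r normrN gtr0_norm.
- move=> uP; have near_e e : 0 < e ->
      \forall h \near 0^'+, (sup_norm (u h) <= e%:E)%E.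
    move=> e0; have [r r0 rP] := uP e e0.
    near=> h; apply: ge_ereal_sup => _ [x _ <-]; rewrite lee_fin; apply: rP.
      by near: h; exact: nbhs_right_gt.
    by near: h; exact: nbhs_right_lt.
  have fin_u : \forall h \near 0^'+, sup_norm (u h) \is a fin_num.
    near=> h; rewrite ge0_fin_numE//.
    apply: (@le_lt_trans _ _ 1%:E); last exact: ltry.
    by near: h; exact: near_e.
  apply/fine_cvgP; split => //.
  apply/cvgrPdist_le => e e0; near=> h.
  rewrite sub0r normrN ger0_norm ?fine_ge0// -lee_fin fineK.
    by near: h; exact: near_e.
  by near: h.
Unshelve. all: by end_near. Qed.

(** * Closure properties of [BUC] and the cutoff functions *)

Section BUCTheory.
Variables (R : realType) (G : zmodType) (d : G -> G -> R).
Hypothesis d_metric : translation_invariant_metric d.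
Implicit Types f g u : G -> R.

Lemma BUCP f : BUC d f <->
  (exists M, forall x, `|f x| <= M) /\ metric_unif_continuous d f.
Proof.
have PF : ProperFilter (globally [set: G]) := globally_properfilter (I : setT 0).
split=> [[/(ex_bound _).1[M fM] uf]|[[M fM] uf]]; split => //.
  by exists M => x; exact: fM.
by apply/(ex_bound _).2; exists M => x _; exact: fM.
Qed.

Lemma BUC_cst (a : R) : BUC d (cst a).
Proof.
apply/BUCP; split; first by exists `|a|.
by move=> e e0; exists 1 => // x y _; rewrite subrr normr0.
Qed.

Lemma BUC_lincomb (a : R) f g :
  BUC d f -> BUC d g -> BUC d ((a \*o f) \+ g).
Proof.
move=> /BUCP[[M fM] uf] /BUCP[[N gN] ug]; apply/BUCP; split.
  exists (`|a| * M + N) => x /=.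
  by rewrite (le_trans (ler_normD _ _))// lerD// normrM ler_wpM2l.
move=> e e0; pose k := `|a| + 1.
have k0 : 0 < k by rewrite ltr_pwDr.
have [r1 r10 r1P] := uf (e / 2 / k) ltac:(by rewrite !divr_gt0).
have [r2 r20 r2P] := ug (e / 2) ltac:(by rewrite divr_gt0).
exists (Num.min r1 r2) => [|x y]; first by rewrite lt_min r10 r20.
rewrite lt_min => /andP[/r1P fxy /r2P gxy] /=.
have -> : a * f x + g x - (a * f y + g y) = a * (f x - f y) + (g x - g y).
  by lra.
rewrite (le_lt_trans (ler_normD _ _))// [ltRHS](splitr e) ler_ltD//.
rewrite normrM; apply: (@le_trans _ _ (k * `|f x - f y|)).
  by rewrite ler_wpM2r// lerDl.
by rewrite mulrC -ler_pdivlMr// ltW.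
Qed.

Lemma tim_translate x y z : d (z + x) (z + y) = d x y.
Proof. by rewrite ![z + _]addrC (tim_invariant d_metric). Qed.

Lemma BUC_translate f x : BUC d f -> BUC d (fun y => f (x + y)).
Proof.
move=> /BUCP[[M fM] uf]; apply/BUCP; split; first by exists M => y.
move=> e e0; have [r r0 rP] := uf e e0; exists r => // y z yz.
by apply: rP; rewrite tim_translate.
Qed.

(** A modulus of continuity common to all members passes to their supremum. Serves both
    [sup_generator] and [J]. *)
Lemma BUC_sup (I : Type) (F : I -> G -> R) :
  [set: I] !=set0 -> uniformly_bounded F -> uniformly_equicontinuous d F ->
  BUC d (fun x => sup (range (fun i => F i x))).
Proof.
move=> I0 [M FM] ueF; apply/BUCP; have [i0 _] := I0; split.
  exists M => x; rewrite ler_norml; apply/andP; split.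
    apply: le_trans (le_sup_range i0 (fun i => FM i x)).
    by have := FM i0 x; rewrite ler_norml => /andP[].
  by apply: sup_range_le => // i; rewrite (le_trans (ler_norm _)).
move=> e e0; have [r r0 rP] := ueF (e / 2) ltac:(by rewrite divr_gt0).
have le_sup x y : d x y < r ->
    sup (range (fun i => F i x)) <= sup (range (fun i => F i y)) + e / 2.
  move=> xy; apply: sup_range_le => // i.
  have := rP i x y xy; have := le_sup_range i (fun i => FM i y).
  rewrite ltr_norml; lra.
exists r => // x y xy; have yx : d y x < r by rewrite (tim_sym d_metric).
by have := le_sup x y xy; have := le_sup y x yx; rewrite ltr_norml; lra.
Qed.

(** A continuous substitute for the indicator of the points at distance at least [r] from 0: it is 1
    there, vanishes at 0, and has Lipschitz constant [1 / r]. *)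
Definition cutoff (r : R) : G -> R := fun y => Num.min 1 (d 0 y / r).

Lemma cutoff_ge0 r y : 0 < r -> 0 <= cutoff r y.
Proof.
by move=> r0; rewrite le_min ler01 divr_ge0 ?(tim_ge0 d_metric) ?ltW.
Qed.

Lemma BUC_cutoff r : 0 < r -> BUC d (cutoff r).
Proof.
move=> r0; apply/BUCP; split.
  by exists 1 => y; rewrite ger0_norm ?cutoff_ge0// ge_min lexx.
have lip x y : cutoff r x <= cutoff r y + d x y / r.
  have dxy : 0 <= d x y / r by rewrite divr_ge0 ?(tim_ge0 d_metric) ?ltW.
  have : d 0 x / r <= d 0 y / r + d x y / r.
    rewrite -mulrDl ler_pM2r ?invr_gt0// (tim_sym d_metric x).
    exact: tim_triangle.
  rewrite /cutoff; case: (leP 1 (d 0 x / r)); case: (leP 1 (d 0 y / r)); lra.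
move=> e e0; exists (e * r) => [|x y xy]; first exact: mulr_gt0.
have := lip x y; have := lip y x; rewrite (tim_sym d_metric y).
have : d x y / r < e by rewrite ltr_pdivrMr.
rewrite ltr_norml; lra.
Qed.

End BUCTheory.

(** * A single Markovian convolution operator *)

Section MarkovianConvolution.
Variables (R : realType) (G : zmodType) (d : G -> G -> R).
Variable (T : (G -> R) -> G -> R).
Hypothesis d_metric : translation_invariant_metric d.
Hypothesis T_conv : markovian_convolution d T.
Implicit Types f g u : G -> R.

(** Combines monotonicity, linearity and preservation of constants. Linearity leaves the sign of [a]
    free, so lower bounds follow as well. *)
Lemma mc_le_affine u f g (a b : R) : BUC d u -> BUC d f -> BUC d g ->
  (forall y, u y <= f y + a * g y + b) ->
  forall x, T u x <= T f x + a * T g x + b.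
Proof.
move=> uB fB gB le_u x; have bB := BUC_cst d b.
have fbB : BUC d ((1 \*o f) \+ cst b) by exact: BUC_lincomb.
have := ce_monotone (mc_expectation T_conv x) uB (BUC_lincomb a gB fbB).
have -> : T ((a \*o g) \+ ((1 \*o f) \+ cst b)) x = T f x + a * T g x + b.
  rewrite !(mc_linear T_conv)//= (ce_cst (mc_expectation T_conv x)).
  by rewrite mul1r; lra.
by apply => y /=; have := le_u y; lra.
Qed.

Lemma mc_contraction f g (e : R) : BUC d f -> BUC d g ->
  (forall y, `|f y - g y| <= e) -> forall x, `|T f x - T g x| <= e.
Proof.
move=> fB gB fg x.
have le u v : BUC d u -> BUC d v -> (forall y, u y <= v y + e) ->
    T u x <= T v x + e.
  move=> uB vB uv; have -> : T v x = T v x + 0 * T v x by lra.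
  by apply: mc_le_affine => // y; have := uv y; lra.
have fg_le : T f x <= T g x + e.
  by apply: le => // y; have := fg y; rewrite ler_norml; lra.
have gf_le : T g x <= T f x + e.
  by apply: le => // y; have := fg y; rewrite ler_norml; lra.
by rewrite ler_norml; lra.
Qed.

Lemma mc_bound f (M : R) :
  BUC d f -> (forall y, `|f y| <= M) -> forall x, `|T f x| <= M.
Proof.
move=> fB fM x; have := mc_contraction fB (BUC_cst d 0) _ x.
rewrite (ce_cst (mc_expectation T_conv x)) subr0; apply => y.
by rewrite subr0.
Qed.

(** By invariance of [d], the translates of [f] by [x] and [y] differ by at most [e] everywhere;
    contraction compares their images at 0. *)
Lemma mc_modulus f (r e : R) : BUC d f ->
  (forall x y, d x y < r -> `|f x - f y| <= e) ->
  forall x y, d x y < r -> `|T f x - T f y| <= e.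
Proof.
move=> fB fr x y xy.
rewrite (mc_translation T_conv x fB) (mc_translation T_conv y fB).
apply: mc_contraction => [||z]; [exact: BUC_translate..|].
by apply: fr; rewrite (tim_invariant d_metric).
Qed.

(* The cutoff at [0] controls how much mass [T] moves beyond distance [r]. *)
Lemma mc_dist_cutoff f (r e M : R) : BUC d f -> 0 < r ->
  (forall x, `|f x| <= M) -> (forall x y, d x y < r -> `|f x - f y| <= e) ->
  forall x, `|T f x - f x| <= e + 2 * M * T (cutoff d r) 0.
Proof.
move=> fB r0 fM fr x; rewrite (mc_translation T_conv x fB).
have fxB := BUC_translate d_metric x fB; have cB := BUC_cutoff d_metric r0.
have M0 : 0 <= M by rewrite (le_trans _ (fM 0)).
have e0 : 0 <= e.
  have /(fr 0 0) : d 0 0 < r by rewrite (tim_eq0 d_metric 0 0).2.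
  by apply: le_trans.
(* Within distance [r] the modulus gives [e]; beyond it the cutoff is 1 and [2 * M] bounds the
   difference. *)
have dist y : `|f (x + y) - f x| <= e + 2 * M * cutoff d r y.
  have [yr|ry] := ltP (d 0 y) r.
    rewrite (@le_trans _ _ e)//; last first.
      by rewrite lerDl mulr_ge0 ?mulr_ge0// cutoff_ge0.
    apply: fr; rewrite (tim_sym d_metric) -[x in d x _]addr0.
    by rewrite tim_translate.
  have -> : cutoff d r y = 1 by apply/min_idPl; rewrite ler_pdivlMr// mul1r.
  rewrite (le_trans (ler_normB _ _))//.
  by have := fM x; have := fM (x + y); lra.
have fcB := BUC_cst d (f x).
have TfxE : T (cst (f x)) 0 = f x by rewrite (ce_cst (mc_expectation T_conv 0)).
have up : T (fun y => f (x + y)) 0 <= f x + 2 * M * T (cutoff d r) 0 + e.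
  rewrite -[X in X + _ * _]TfxE; apply: mc_le_affine => // y /=.
  by have := dist y; rewrite ler_norml; lra.
have lo : f x <= T (fun y => f (x + y)) 0 + 2 * M * T (cutoff d r) 0 + e.
  rewrite -[leLHS]TfxE; apply: mc_le_affine => // y /=.
  by have := dist y; rewrite ler_norml; lra.
by rewrite ler_norml; lra.
Qed.

End MarkovianConvolution.

(* Splitting [0, t] into n steps of length h = t / n, each increment
   S(kh)(S(h) f - f) is h S(kh) g up to o(h), which replaces the formula
   S(t) f - f = \int_0^t S(s) g ds. *)
Lemma generator_increment (R : realType) (G : zmodType) (d : G -> G -> R)
  (S : R -> (G -> R) -> G -> R) (f g : G -> R) (t b eta : R) (x : G) :
  markovian_convolution_semigroup d S -> BUC d f -> BUC d g ->
  generator_at S f g -> 0 <= t ->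
  (forall s, 0 <= s -> s <= t -> `|S s g x - b| <= eta) ->
  `|S t f x - f x - t * b| <= t * eta.
Proof.
move=> Ssg fB gB /cvg_sup_norm0 genf; rewrite le_eqVlt => /predU1P[<- _|t0 gb].
  by rewrite (mcs_0 Ssg fB) subrr !mul0r subr0 normr0.
rewrite -ler_pdivrMl//; apply/ler_addgt0Pr => e e0; rewrite ler_pdivrMl//.
have [r r0 rP] := genf e e0.
(* The successor makes [n] exceed [t / r] strictly, so the step [h] is below [r]. *)
pose n := (Num.trunc (t / r)).+1.
have n0 : (0 : R) < n%:R by rewrite ltr0n.
pose h := t / n%:R.
have h0 : 0 < h by rewrite divr_gt0.
have hr : h < r.
  rewrite ltr_pdivrMr// mulrC -ltr_pdivrMr//.
  by apply: truncnS_gt.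
have tE : t = n%:R * h by rewrite /h mulrCA divff ?mulr1// gt_eqF.
have Sh y : `|S h f y - f y - h * g y| <= h * e.
  have -> : S h f y - f y - h * g y = h * ((S h f y - f y) / h - g y).
    by rewrite mulrBr mulrCA divff ?mulr1 ?gt_eqF.
  by rewrite normrM gtr0_norm// ler_pM2l// rP.
(* Each step applies [S (k%:R * h)] to the estimate [Sh], at cost [h * e]; replacing
   [S (k%:R * h) g x] by [b] costs [h * eta]. *)
have step k : (k <= n)%N ->
    `|S (k%:R * h) f x - f x - k%:R * h * b| <= k%:R * h * (eta + e).
  elim: k => [_|k IHk kn].
    by rewrite !mul0r (mcs_0 Ssg fB) subrr subr0 normr0.
  have kh0 : 0 <= k%:R * h by rewrite mulr_ge0// ltW.
  have kht : k%:R * h <= t by rewrite tE ler_pM2r// ler_nat ltnW.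
  have mc := mcs_convolution Ssg kh0.
  have ShB := mc_BUC (mcs_convolution Ssg (ltW h0)) fB.
  have -> : k.+1%:R * h = k%:R * h + h by rewrite -natr1; lra.
  rewrite (mcs_D Ssg kh0 (ltW h0) fB).
  have up : S (k%:R * h) (S h f) x <=
      S (k%:R * h) f x + h * S (k%:R * h) g x + h * e.
    by apply: (mc_le_affine mc) => // y; have := Sh y; rewrite ler_norml; lra.
  have lo : S (k%:R * h) f x <=
      S (k%:R * h) (S h f) x + (- h) * S (k%:R * h) g x + h * e.
    by apply: (mc_le_affine mc) => // y; have := Sh y; rewrite ler_norml; lra.
  have : `|h * (S (k%:R * h) g x - b)| <= h * eta.
    by rewrite normrM gtr0_norm// ler_pM2l// gb.
  have := IHk (ltnW kn); rewrite !ler_norml; lra.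
by have := step n (leqnn n); rewrite -tE.
Qed.

(** * Estimates uniform in the index [l], and the operators [J] *)

Section CommonDomain.
Variables (R : realType) (G : zmodType) (d : G -> G -> R).
Variables (Lam : Type) (S : Lam -> R -> (G -> R) -> G -> R).
Variables (dom : Lam -> set (G -> R)) (A : Lam -> (G -> R) -> G -> R).
Hypothesis d_metric : translation_invariant_metric d.
Hypothesis Lam_nonempty : [set: Lam] !=set0.
Hypothesis S_semigroup : forall l, markovian_convolution_semigroup d (S l).
Hypothesis A_generator : forall l, is_generator d (S l) (dom l) (A l).
Hypothesis D_dense : dense_in_BUC d (common_domain d dom A).
Implicit Types f g u : G -> R.

Let S_conv l t : 0 <= t -> markovian_convolution d (S l t).
Proof. exact: mcs_convolution. Qed.

Lemma common_domain_BUC f : common_domain d dom A f -> BUC d f.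
Proof.
have [l _] := Lam_nonempty; move=> [/(_ l)].
by rewrite (gen_dom (A_generator l)) => -[].
Qed.

(** This is [generator_increment] with [b = 0]: by contraction the uniform bound of the [A l f] also
    bounds [S l s (A l f)]. *)
Lemma common_domain_growth f : common_domain d dom A f ->
  exists2 C, 0 <= C & forall l t x, 0 <= t -> `|S l t f x - f x| <= t * C.
Proof.
move=> Df; have fB := common_domain_BUC Df; have [fdom [C AC] _] := Df.
exists C; first by have [l _] := Lam_nonempty; rewrite (le_trans _ (AC l 0)).
move=> l t x t0; have [AB Agen] := gen_op (A_generator l) (fdom l).
have := @generator_increment _ _ _ _ _ _ t 0 C x (S_semigroup l) fB AB Agen t0.
rewrite mulr0 subr0; apply => s s0 _; rewrite subr0.
exact: (mc_bound (S_conv l s0)).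
Qed.

Lemma common_domain_approx u (e : R) : BUC d u -> 0 < e ->
  exists2 g, common_domain d dom A g & forall x, `|u x - g x| <= e.
Proof.
move=> uB e0; have [g Dg /ltW uge] := D_dense uB e0; exists g => // x.
rewrite -lee_fin; apply: le_trans uge.
by apply: ereal_sup_ubound; exists x.
Qed.

(** Density supplies [g] in the common domain near the cutoff. The three thirds of [e] are the
    approximation under [S l t], the growth of [g], and the approximation at 0, where the cutoff
    vanishes. *)
Lemma cutoff_small (r e : R) : 0 < r -> 0 < e ->
  exists2 t0, 0 < t0 &
    forall l t, 0 <= t -> t <= t0 -> S l t (cutoff d r) 0 <= e.
Proof.
move=> r0 e0; have cB := BUC_cutoff d_metric r0.
have e3 : 0 < e / 3 by rewrite divr_gt0.
have [g Dg cg] := common_domain_approx cB e3.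
have gB := common_domain_BUC Dg.
have [C C0 gC] := common_domain_growth Dg.
have C1 : 0 < C + 1 by rewrite ltr_wpDl.
exists (e / 3 / (C + 1)) => [|l t t0 tle]; first exact: divr_gt0.
have tC : t * C <= e / 3.
  by move: tle; rewrite ler_pdivlMr//; lra.
have := mc_contraction (S_conv l t0) cB gB cg 0.
have c0 : cutoff d r 0 = 0.
  by rewrite /cutoff (tim_eq0 d_metric 0 0).2// mul0r; apply/min_idPr.
have := gC l t 0 t0; have := cg 0; rewrite c0 !ler_norml; lra.
Qed.

(** The function may vary with [l], as needed for [F l = A l f]. One half of [e] pays for the common
    modulus, the other for the mass moved beyond [r]. *)
Lemma equicontinuous_strong_continuity (F : Lam -> G -> R) (e : R) :
  (forall l, BUC d (F l)) -> uniformly_bounded F ->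
  uniformly_equicontinuous d F -> 0 < e ->
  exists2 t0, 0 < t0 &
    forall l t x, 0 <= t -> t <= t0 -> `|S l t (F l) x - F l x| <= e.
Proof.
move=> FB [M FM] ueF e0; have e2 : 0 < e / 2 by rewrite divr_gt0.
have [r r0 rP] := ueF _ e2.
have M0 : 0 <= M by have [l _] := Lam_nonempty; rewrite (le_trans _ (FM l 0)).
have k0 : 0 < 2 * M + 1 by rewrite ltr_wpDl ?mulr_ge0.
have [t0 t00 t0P] := cutoff_small r0 (divr_gt0 e2 k0).
exists t0 => // l t x tge0 tle.
have := mc_dist_cutoff d_metric (S_conv l tge0) (FB l) r0 (FM l)
  (fun x y xy => ltW (rP l x y xy)) x.
have c0 : 0 <= S l t (cutoff d r) 0.
  have := ce_monotone (mc_expectation (S_conv l tge0) 0) (BUC_cst d 0)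
    (BUC_cutoff d_metric r0) (fun y => cutoff_ge0 d_metric y r0).
  by rewrite (ce_cst (mc_expectation (S_conv l tge0) 0)).
by have := t0P l t tge0 tle; rewrite ler_pdivlMr//; lra.
Qed.

(** Takes [b = A l f x] in [generator_increment]; equicontinuity of the [A l f] makes [t0] common to
    all [l]. *)
Lemma common_domain_expansion f (e : R) : common_domain d dom A f -> 0 < e ->
  exists2 t0, 0 < t0 & forall l t x, 0 <= t -> t <= t0 ->
    `|S l t f x - f x - t * A l f x| <= t * e.
Proof.
move=> Df e0; have fB := common_domain_BUC Df; have [fdom Ab Aue] := Df.
have Agen l := gen_op (A_generator l) (fdom l).
have [t0 t00 t0P] :=
  equicontinuous_strong_continuity (fun l => (Agen l).1) Ab Aue e0.
exists t0 => // l t x tge0 tle; have [AB genA] := Agen l.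
apply: (generator_increment (S_semigroup l) fB AB genA tge0) => s s0 st.
by rewrite t0P// (le_trans st).
Qed.

Lemma sup_generator_BUC f : common_domain d dom A f -> BUC d (sup_generator A f).
Proof. by move=> [_ Ab Aue]; exact: BUC_sup. Qed.

Lemma le_J l t f x : BUC d f -> 0 <= t -> S l t f x <= J S t f x.
Proof.
move=> fB t0; have /BUCP[[M fM] _] := fB.
apply: (@le_sup_range _ _ (fun l => S l t f x) M) => j.
exact: (mc_bound (S_conv j t0)).
Qed.

Lemma BUC_J t f : BUC d f -> 0 <= t -> BUC d (J S t f).
Proof.
move=> fB t0; have /BUCP[[M fM] uf] := fB; apply: BUC_sup => //.
  by exists M => l x; exact: (mc_bound (S_conv l t0)).
move=> e e0; have [r r0 rP] := uf (e / 2) ltac:(by rewrite divr_gt0).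
exists r => // l x y xy; apply: (@le_lt_trans _ _ (e / 2)); last by lra.
apply: (mc_modulus d_metric (S_conv l t0) fB _ xy) => x' y' xy'.
exact/ltW/rP.
Qed.

Lemma BUC_J_seq f t s : BUC d f -> path <=%R t s -> BUC d (J_seq S (t :: s) f).
Proof.
move=> fB; elim: s t => [//|t1 s IHs] t /= /andP[tt1 pths].
by apply: BUC_J; [exact: IHs|rewrite subr_ge0].
Qed.

(* The quadratic term absorbs the growth of [psi] under the successive
   operators [J]. *)
Lemma J_seq_le f psi (e C h : R) : BUC d f -> BUC d psi -> 0 <= C ->
  (forall l t x, 0 <= t -> t <= h -> S l t f x <= f x + t * (psi x + e)) ->
  (forall l t x, 0 <= t -> t <= h -> S l t psi x <= psi x + t * C) ->
  forall t s, path <=%R t s -> last t s - t <= h ->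
  forall x, J_seq S (t :: s) f x <=
    f x + (last t s - t) * (psi x + e) + (last t s - t) ^+ 2 * C.
Proof.
move=> fB psiB C0 fle psile t s; elim: s t => [|t1 s IHs] t.
  by move=> _ _ x /=; rewrite subrr expr0n !mul0r !addr0.
move=> /= /andP[tt1 pths] lasth x.
have t1last : t1 <= last t1 s by rewrite path_le_last ?mem_head.
have uB := BUC_J_seq fB pths.
have := IHs t1 pths ltac:(lra).
set tau := last t1 s - t1; set dt := t1 - t.
have -> : last t1 s - t = dt + tau by rewrite /dt /tau; lra.
have dt0 : 0 <= dt by rewrite subr_ge0.
have tau0 : 0 <= tau by rewrite subr_ge0.
have dth : dt <= h by rewrite /dt; lra.
move=> ule; apply: sup_range_le => // l.
(* The induction bound is affine in [f] and [psi], so [S l dt] passes through it; the growth of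
   [psi] then costs [dt * tau * C]. *)
have : S l dt (J_seq S (t1 :: s) f) x <=
    S l dt f x + tau * S l dt psi x + (tau * e + tau ^+ 2 * C).
  apply: (mc_le_affine (S_conv l dt0)) => // y; apply: le_trans (ule y) _.
  by lra.
have : tau * S l dt psi x <= tau * (psi x + dt * C).
  by rewrite ler_wpM2l// psile.
have := fle l dt x dt0 dth.
have : 0 <= dt * tau * C by rewrite !mulr_ge0.
have : 0 <= dt ^+ 2 * C by rewrite mulr_ge0// sqr_ge0.
(* One of the two cross terms covers the growth of [psi]; the other and [dt ^+ 2 * C] are
   nonnegative slack. *)
have -> : (dt + tau) ^+ 2 * C = dt ^+ 2 * C + 2 * (dt * tau * C) + tau ^+ 2 * C.
  by lra.
have -> : tau * (psi x + dt * C) = tau * psi x + dt * tau * C by lra.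
lra.
Qed.

End CommonDomain.

(** * Finite partitions as sorted lists *)

Section Partitions.
Variables (R : realType) (G : zmodType).
Variables (Lam : Type) (S : Lam -> R -> (G -> R) -> G -> R).

(** Sorting puts the minimum 0 first and the maximum [t] last, which is the shape that [J_seq_le]
    expects. *)
Lemma sort_partition (t : R) (pi : {fset R}) : partitions t pi ->
  exists s, [/\ sort <=%R (enum_fset pi) = 0 :: s, path <=%R 0 s & last 0 s = t].
Proof.
move=> [pi_ge0 pi0 pit pi_le].
have := sort_sorted (@le_total _ R) (enum_fset pi).
have mem_s x : (x \in sort <=%R (enum_fset pi)) = (x \in pi).
  by rewrite mem_sort.
case sE : (sort _ _) mem_s => [|a s] mem_s /= pths.
  by have := mem_s 0; rewrite pi0.
have amin x : x \in a :: s -> a <= x.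
  rewrite inE => /predU1P[-> //|]; exact: (allP (order_path_min le_trans pths)).
have a0 : a = 0.
  apply/le_anti/andP; split; first by rewrite amin// mem_s.
  by rewrite pi_ge0// -mem_s mem_head.
exists s; rewrite -a0; split => //.
apply/le_anti/andP; split; first by rewrite pi_le// -mem_s mem_last.
by rewrite path_le_last ?mem_s.
Qed.

Lemma partitions_pair (h : R) : 0 < h -> partitions h [fset 0; h]%fset.
Proof.
move=> h0; split => [s|||s]; rewrite !inE ?eqxx ?orbT//.
  by case/predU1P => [->|/eqP ->]; rewrite // ltW.
by case/predU1P => [->|/eqP ->]; rewrite // ltW.
Qed.

Lemma J_part_pair (h : R) (f : G -> R) :
  0 < h -> J_part S [fset 0; h]%fset f = J S h f.
Proof.
move=> h0; rewrite /J_part.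
have -> : sort <=%R (enum_fset [fset 0; h]%fset) = [:: 0; h].
  apply: (sorted_eq le_trans le_anti); first exact: sort_sorted (@le_total _ R) _.
    by rewrite /= ltW.
  rewrite perm_sort; apply: uniq_perm => [||x]; first exact: fset_uniq.
    by rewrite /= inE andbT lt_eqF.
  by rewrite !inE.
by rewrite /= subr0.
Qed.

End Partitions.

(** * Two-sided bounds for the difference quotient *)

Theorem lemma5p10 (R : realType) (G : zmodType) (d : G -> G -> R)
  (d_metric : translation_invariant_metric d)
  (G_separable : metric_separable d) (G_complete : metric_complete d)
  (Lam : Type) (Lam_nonempty : [set: Lam] !=set0)
  (S : Lam -> R -> (G -> R) -> G -> R)
  (S_semigroup : forall l, markovian_convolution_semigroup d (S l))
  (dom : Lam -> set (G -> R)) (A : Lam -> (G -> R) -> G -> R)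
  (A_generator : forall l, is_generator d (S l) (dom l) (A l))
  (D_dense : dense_in_BUC d (common_domain d dom A))
  (f : G -> R) (f_D : common_domain d dom A f) :
  sup_norm (fun x => (sup_semigroup S h f x - f x) / h - sup_generator A f x)
    @[h --> 0^'+] --> 0%E.
Proof.
apply/cvg_sup_norm0 => e e0; have e4 : 0 < e / 4 by rewrite divr_gt0.
have fB := common_domain_BUC Lam_nonempty A_generator f_D.
have [_ [M AM] _] := f_D.
have A_le l x : A l f x <= sup_generator A f x.
  exact: (@le_sup_range _ _ (fun l => A l f x) M).
have [psi Dpsi psi_close] := common_domain_approx D_dense
  (sup_generator_BUC d_metric Lam_nonempty f_D) e4.
have psiB := common_domain_BUC Lam_nonempty A_generator Dpsi.
have [C C0 psi_growth] :=
  common_domain_growth Lam_nonempty S_semigroup A_generator Dpsi.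
have [t0 t00 f_exp] := common_domain_expansion d_metric Lam_nonempty
  S_semigroup A_generator D_dense f_D e4.
have C1 : 0 < C + 1 by rewrite ltr_wpDl.
(* Below [t0] the expansion of [f] holds; the second term gives [h * C < e / 4] for the quadratic
   error. *)
exists (Num.min t0 (e / 4 / (C + 1))) => [|h x h0].
  by rewrite lt_min t00 divr_gt0.
rewrite lt_min => /andP[/ltW ht0]; rewrite ltr_pdivlMr// => hC.
have ub pi : partitions h pi ->
    J_part S pi f x <= f x + h * (sup_generator A f x + e).
  move=> /sort_partition[s [piE pths lasts]]; rewrite /J_part piE.
  have lasth : last 0 s - 0 = h by rewrite lasts subr0.
  (* The error [e / 2] is [e / 4] from the expansion plus [e / 4] from replacing [sup_generator A f]
     by [psi]. *)
  have := @J_seq_le _ _ _ _ _ d_metric Lam_nonempty S_semigroup f psi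
    (e / 2) C h fB psiB C0 _ _ 0 s pths.
  rewrite lasth => le; apply: le_trans (le _ _ _ x) _ => //.
  - move=> l t y tge0 th.
    have : t * A l f y <= t * (psi y + e / 4).
      rewrite ler_wpM2l//; have := A_le l y; have := psi_close y.
      by rewrite ler_norml; lra.
    have := f_exp l t y tge0 (le_trans th ht0); rewrite ler_norml; lra.
  - move=> l t y tge0 _; have := psi_growth l t y tge0.
    by rewrite ler_norml; lra.
  (* Returning from [psi] to [sup_generator A f] costs [e / 4], and [h * C] takes the last
     quarter. *)
  rewrite -addrA lerD2l expr2 -mulrA -mulrDr ler_pM2l//.
  by have := psi_close x; rewrite ler_norml; lra.
have up : sup_semigroup S h f x <= f x + h * (sup_generator A f x + e).
  apply: ge_sup => [|_ [pi piP <-]]; last exact: ub.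
  by exists (J_part S [fset 0; h]%fset f x), [fset 0; h]%fset => //;
     exact: partitions_pair.
(* [ub] bounds the set of values above, so the real-valued [sup] does dominate the value at this
   partition. *)
have J_le : J S h f x <= sup_semigroup S h f x.
  rewrite -J_part_pair//; apply: ub_le_sup.
    by exists (f x + h * (sup_generator A f x + e)) => _ [pi piP <-]; exact: ub.
  by exists [fset 0; h]%fset => //; exact: partitions_pair.
(* For each [l], [S l h f] lies below [J S h f], hence below [sup_semigroup S h f]. *)
have lo : sup_generator A f x <= (sup_semigroup S h f x - f x) / h + e.
  apply: sup_range_le => // l; rewrite -lerBlDr ler_pdivlMr//.
  have := le_J S_semigroup l x fB (ltW h0).
  have := f_exp l h x (ltW h0) ht0.
  have : 0 <= h * e by rewrite mulr_ge0// ltW.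
  by rewrite ler_norml; lra.
have up' : (sup_semigroup S h f x - f x) / h <= sup_generator A f x + e.
  by rewrite ler_pdivrMr//; lra.
by rewrite ler_norml; lra.
Qed.
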